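(* The generating function $\mathcal A=\sum_{n\ge0}\mathcal A_n^{FC}(q)x^n$ of fully commutative involutions of type $A$ satisfies $$\mathcal A=\frac{\sum_{j\ge0}x^j\,{j\brack \lfloor j/2\rfloor}_{q^2}\,q^{-\lfloor j/2\rfloor^2+\chi(j\ \mathrm{odd})}}{1+\sum_{j\ge1}(-x)^j\,{j-1\brack \lfloor j/2\rfloor}_{q^2}\,q^{-\lfloor j/2\rfloor^2}},$$ where $\chi(j\ \mathrm{odd})$ is $1$ if $j$ is odd and $0$ otherwise, and ${k\brack i}_{q^2}=\frac{(q^2;q^2)_k}{(q^2;q^2)_i(q^2;q^2)_{k-i}}$.
   Context: $A_n$ is the Coxeter group of type $A_n$ (symmetric group on $n+1$ letters with the $n$ adjacent transpositions), $A_0$ trivial. $w$ is fully commutative if any reduced expression can be obtained from any other using only commutation relations $st=ts$ ($m_{st}=2$); a fully commutative involution is such $w$ with $w^2=1$ (identity included). $\mathcal A_n^{FC}(q)=\sum q^{\ell(w)}$ over fully commutative involutions $w$ of $A_n$. $(a;q^2)_n=(1-a)(1-aq^2)\cdots(1-aq^{2n-2})$. *)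

(* Defs.v *)
From HB Require Import structures.
From mathcomp Require Import all_boot all_order all_fingroup all_algebra.

Set Implicit Arguments.
Unset Strict Implicit.
Unset Printing Implicit Defensive.

Import GRing.Theory.

Section TypeA.
Variable n : nat.
Local Open Scope group_scope.

Definition adj_transp (i : 'I_n) : 'S_n.+1 :=
  tperm (widen_ord (leqnSn n) i) (lift ord0 i).

Definition coxeter_m (i j : 'I_n) : nat := #[adj_transp i * adj_transp j].

Definition word_prod (a : seq 'I_n) : 'S_n.+1 := \prod_(i <- a) adj_transp i.

Definition has_word_of_size (w : 'S_n.+1) (k : nat) : bool :=
  [exists a : k.-tuple 'I_n, word_prod a == w].

Lemma adj_transp_gen : <<[set adj_transp i | i : 'I_n]>> = [set: 'S_n.+1].
Proof.
apply/eqP; rewrite eqEsubset subsetT -(gen_tperm ord0) gen_subG.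
apply/subsetP=> _ /imsetP[[k ltk] _ ->].
elim: k ltk => [|k IHk] ltk.
  by rewrite (_ : Ordinal ltk = ord0) ?tperm1 ?group1 //; apply: val_inj.
have ltkn : k < n by [].
have sk : adj_transp (Ordinal ltkn) \in <<[set adj_transp i | i : 'I_n]>>.
  by apply/mem_gen/imsetP; exists (Ordinal ltkn).
have skE : adj_transp (Ordinal ltkn) = tperm (Ordinal (ltnW ltk)) (Ordinal ltk).
  by congr tperm; apply: val_inj.
have [k0|k_gt0] := posnP k.
  rewrite skE in sk.
  by rewrite (_ : ord0 = Ordinal (ltnW ltk)) //; apply: val_inj; rewrite /= k0.
rewrite (_ : tperm _ _ = tperm ord0 (Ordinal (ltnW ltk)) ^ adj_transp (Ordinal ltkn)).
  by rewrite groupJ // IHk.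
by rewrite tpermJ skE tpermL tpermD // -val_eqE /= -lt0n.
Qed.

Lemma has_word (w : 'S_n.+1) : exists k, has_word_of_size w k.
Proof.
have: w \in <<[set adj_transp i | i : 'I_n]>> by rewrite adj_transp_gen inE.
case/gen_prodgP=> k [c Ac ->]; exists k.
have /fin_all_exists[f fE] i : exists j, c i = adj_transp j.
  by have /imsetP[j _ ->] := Ac i; exists j.
apply/existsP; exists [tuple f i | i < k]; apply/eqP.
by rewrite /word_prod /= big_map enumT; apply: eq_bigr => i _; rewrite fE.
Qed.

Definition coxeter_length (w : 'S_n.+1) : nat := ex_minn (has_word w).

Definition reduced_expr (w : 'S_n.+1) (a : (coxeter_length w).-tuple 'I_n) : bool :=
  word_prod a == w.

(* One application of a relation st = ts with m_st = 2: the adjacent letters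
   in positions i and i + 1 of the word a are exchanged. *)
Definition commutation_move (k : nat) : rel (k.-tuple 'I_n) := fun a b =>
  [exists i : 'I_k, exists j : 'I_k,
    [&& j == i.+1 :> nat, coxeter_m (tnth a i) (tnth a j) == 2
      & b == [tuple tnth a (tperm i j l) | l < k]]].

Definition fully_commutative (w : 'S_n.+1) : bool :=
  [forall a : (coxeter_length w).-tuple 'I_n,
   forall b : (coxeter_length w).-tuple 'I_n,
    reduced_expr a ==> reduced_expr b ==> connect (@commutation_move _) a b].

Definition fc_involution (w : 'S_n.+1) : bool :=
  fully_commutative w && (w ^+ 2 == 1).

End TypeA.

Local Open Scope ring_scope.

Definition fc_inv_poly (n : nat) : {poly int} :=
  \sum_(w : 'S_n.+1 | fc_involution w) 'X^(coxeter_length w).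

Section QAnalogues.
Variable K : fieldType.

Definition q_pochhammer (a p : K) (n : nat) : K := \prod_(i < n) (1 - a * p ^+ i).

(* Only meaningful for i <= k and p not a root of unity. *)
Definition q_binomial (p : K) (k i : nat) : K :=
  q_pochhammer p p k / (q_pochhammer p p i * q_pochhammer p p (k - i)).

End QAnalogues.

(* A formal power series is given by its sequence of coefficients. *)
Section PowerSeries.
Variable K : fieldType.
Implicit Types f g d : nat -> K.

Definition fps_mul f g : nat -> K := fun n => \sum_(i < n.+1) f i * g (n - i)%N.

(* The first n coefficients of f / d, for d 0 != 0. *)
Fixpoint fps_div_seq f d (n : nat) : seq K :=
  if n is m.+1 then
    let s := fps_div_seq f d m in
    rcons s ((f m - \sum_(i < m) s`_i * d (m - i)%N) / d 0%N)
  else [::].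

Definition fps_div f d : nat -> K := fun n => (fps_div_seq f d n.+1)`_n.

Lemma size_fps_div_seq f d n : size (fps_div_seq f d n) = n.
Proof. by elim: n => //= n IHn; rewrite size_rcons IHn. Qed.

Lemma nth_fps_div_seq f d n i : (i < n)%N ->
  (fps_div_seq f d n)`_i = fps_div f d i.
Proof.
elim: n => // n IHn; rewrite ltnS leq_eqVlt => /predU1P[-> //|lt_in] /=.
by rewrite nth_rcons size_fps_div_seq lt_in IHn.
Qed.

Lemma fps_divE f d n :
  fps_div f d n = (f n - \sum_(i < n) fps_div f d i * d (n - i)%N) / d 0%N.
Proof.
rewrite {1}/fps_div /= nth_rcons size_fps_div_seq ltnn eqxx.
by under eq_bigr => i _ do rewrite nth_fps_div_seq //.
Qed.

Lemma fps_divK f d : d 0%N != 0 -> fps_mul (fps_div f d) d =1 f.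
Proof.
move=> d0 n; rewrite /fps_mul big_ord_recr /= subnn [in X in _ + X]fps_divE.
by rewrite divfK // addrC subrK.
Qed.

Lemma fps_mulK f d : d 0%N != 0 -> fps_div (fps_mul f d) d =1 f.
Proof.
move=> d0 n; elim/ltn_ind: n => n IHn; rewrite fps_divE.
under eq_bigr => i _ do rewrite IHn //.
by rewrite /fps_mul big_ord_recr /= subnn addrC addrK mulfK.
Qed.

End PowerSeries.

(* The ground field is Q(q), the fraction field of Z[q]; it contains the
   Laurent polynomials in q, and q is not a root of unity in it. *)
Definition qvar : {fraction {poly int}} := tofrac 'X.

(* Main.v *)
Require Import Defs.
From mathcomp Require Import all_boot all_fingroup all_algebra.
From mathcomp Require Import cyclic zify ring.

(** A permutation is fully commutative iff it avoids 321: commutation moves preserve the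
letter counts of a word, a 321 pattern produces a braid, and conversely two left descents
of a 321-avoiding permutation are never adjacent.  In a reduced word of a 321-avoiding
[w] the letter [s_k] occurs [#{x <= k < w x}] times.  Hence, recording for each [x]
whether [w x] is above, below or equal to [x], 321-avoiding involutions become the paths
from height 0 to height 0 that stay nonnegative and have flat steps at height 0 only, and
the length becomes the sum of the heights.

Let [F_h] be the generating function of such paths started at height [h], and [B_h] that
of all paths with steps +1 and -1 from [h] to 0, possibly going below 0.  Both satisfy
the same recursion for [h > 0], so [F_h D = B_h] for a series [D] that is read off at
[h = 0], and [A D = q B_1 + B_0].  The coefficients of [B_h] are powers of [q] times
q-binomials, by the q-Pascal rule. *)

Set Implicit Arguments.
Unset Strict Implicit.
Unset Printing Implicit Defensive.
Import GRing.Theory.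

(** * Length and inversions *)

Section Length.
Variable n : nat.
Implicit Types (w : 'S_n.+1) (i j : 'I_n) (a b : seq 'I_n).
Local Open Scope group_scope.
Local Notation s := (@adj_transp n).

Definition lo (i : 'I_n) : 'I_n.+1 := widen_ord (leqnSn n) i.
Definition hi (i : 'I_n) : 'I_n.+1 := lift ord0 i.

Lemma val_hi i : hi i = i.+1 :> nat.
Proof. by []. Qed.

Lemma val_adj i (x : 'I_n.+1) :
  s i x = (if x == i :> nat then i.+1 else if x == i.+1 :> nat then nat_of_ord i else x) :> nat.
Proof.
rewrite /adj_transp permE /= -!val_eqE /=.
by case: eqP => // _; case: eqP.
Qed.

Lemma adj_spec i (x : 'I_n.+1) :
  (x = i :> nat /\ s i x = i.+1 :> nat) \/ (x = i.+1 :> nat /\ s i x = i :> nat)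
    \/ (x <> i :> nat /\ x <> i.+1 :> nat /\ s i x = x :> nat).
Proof.
rewrite val_adj; case: eqP => [|ne]; first by left.
by right; case: eqP => [|ne']; [left | right].
Qed.

Lemma adj_lo i : s i (lo i) = hi i.
Proof. exact: tpermL. Qed.

Lemma adj_hi i : s i (hi i) = lo i.
Proof. exact: tpermR. Qed.

Lemma adjK i w : s i * (s i * w) = w.
Proof. by rewrite mulgA tperm2 mul1g. Qed.

Lemma adj_lt i (x y : 'I_n.+1) : x < y -> ~~ ((x == i :> nat) && (y == i.+1 :> nat)) ->
  s i x < s i y.
Proof. by move=> ? ?; rewrite !val_adj; repeat (case: ifP => ?); lia. Qed.

Definition inv_set w := [set p : 'I_n.+1 * 'I_n.+1 | (p.1 < p.2) && (w p.2 < w p.1)].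
Definition ninv w := #|inv_set w|.

(** Permutations multiply from left to right, so [s i * w] exchanges the values of [w] at the
    positions [i] and [i.+1]. A left descent is thus a descent of the sequence of values. *)
Definition desc w i := w (hi i) < w (lo i).

Lemma perm_lo_hi w i : w (lo i) != w (hi i) :> nat.
Proof. by apply/eqP=> /val_inj/perm_inj/(congr1 val) /=; rewrite /bump /=; lia. Qed.

Lemma desc_adj w i : desc (s i * w) i = ~~ desc w i.
Proof.
by rewrite /desc !permM adj_lo adj_hi; have := perm_lo_hi w i; lia.
Qed.

(** Applying [s i] to both entries of a pair preserves the order of every increasing pair except
    [(lo i, hi i)]. It therefore carries the inversions of [w] to those of [s i * w], apart from
    this one new pair. *)
Lemma ninv_asc w i : ~~ desc w i -> ninv (s i * w) = (ninv w).+1.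
Proof.
move=> di; have di' : desc (s i * w) i by rewrite desc_adj.
pose f (p : 'I_n.+1 * 'I_n.+1) := (s i p.1, s i p.2).
have fK : involutive f by case=> x y; rewrite /f /= !tpermK.
have -> : ninv (s i * w) = #|(lo i, hi i) |: f @: inv_set w|.
  congr (#|pred_of_set _|); apply/setP=> -[x y].
  rewrite !inE -[(x, y) in RHS]fK.
  rewrite (mem_imset _ _ (inv_inj fK)) !inE /= !permM fK.
  apply/idP/orP => [/andP[lt_xy lt_w]|[/eqP[-> ->]|/andP[lt_xy lt_w]]].
  - case: (boolP ((x, y) == _)) => [_|ne]; [by left | right].
    by rewrite lt_w andbT adj_lt.
  - by move: di'; rewrite /desc !permM => ->; rewrite andbT val_hi.
  - rewrite lt_w andbT -[x](tpermK (lo i) (hi i)) -[y](tpermK (lo i) (hi i)) adj_lt //.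
    apply/negP=> /andP[/eqP e1 /eqP e2]; move: lt_w di; rewrite /desc.
    rewrite (_ : s i x = lo i); last exact: val_inj.
    by rewrite (_ : s i y = hi i) => [->|]; last exact: val_inj.
rewrite cardsU1 card_imset; last exact: inv_inj fK.
rewrite (_ : _ \notin _) // -[(lo i, hi i)]fK (mem_imset _ _ (inv_inj fK)).
by rewrite /f /= adj_lo adj_hi inE /= ltnNge leqnSn.
Qed.

Lemma ninv_desc w i : desc w i -> ninv w = (ninv (s i * w)).+1.
Proof. by move=> di; rewrite -(@ninv_asc _ i) ?adjK // desc_adj negbK. Qed.

Lemma ninv1 : ninv 1 = 0.
Proof.
apply/eqP; rewrite cards_eq0; apply/eqP/setP=> -[x y].
by rewrite !inE !perm1 /=; apply/negP=> /andP[] /ltn_trans h /h; rewrite ltnn.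
Qed.

Lemma word_prod_cons i a : word_prod (i :: a) = s i * word_prod a.
Proof. exact: big_cons. Qed.

Lemma ninv_word a : ninv (word_prod a) <= size a.
Proof.
elim: a => [|i a IHa]; first by rewrite /word_prod big_nil ninv1.
rewrite word_prod_cons /=; have [di|di] := boolP (desc (word_prod a) i).
  by move: (ninv_desc di); lia.
by rewrite ninv_asc.
Qed.

Lemma no_desc1 w : (forall i, ~~ desc w i) -> w = 1.
Proof.
move=> nd.
have incr k (x y : 'I_n.+1) : y = (x + k)%N :> nat -> (w x + k <= w y)%N.
  elim: k y => [|k IHk] y exy; first by rewrite addn0 (_ : x = y) //; apply: ord_inj; lia.
  have lt_k : (x + k < n)%N by move: (ltn_ord y); lia.
  pose i := Ordinal lt_k.
  have := IHk (lo i) erefl; have := nd i; have := perm_lo_hi w i; rewrite /desc => *.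
  by rewrite (_ : y = hi i); [lia | apply: ord_inj; rewrite val_hi /=; lia].
(* Growth from [0] to [x] gives [x <= w x], and growth from [x] to the last position gives
   [w x <= x]. *)
apply/permP=> x; rewrite perm1; apply: val_inj => /=.
have := incr x ord0 x erefl.
have := incr (n - x)%N x ord_max; have := ltn_ord x; have := ltn_ord (w ord_max).
by move=> /=; lia.
Qed.

(** Plain sequences replace tuples whose length depends on [w], so that letters can be removed by
    induction; [reduced_exprE] translates back. *)
Definition reduced w a := (word_prod a == w) && (size a == ninv w).

(** If [i] is an ascent, any word for [s i * w] has more than [ninv w] letters by [ninv_word], so no
    reduced word of [w] starts with [i]. *)
Lemma reduced_cons w i a : reduced w (i :: a) = desc w i && reduced (s i * w) a.
Proof.
rewrite /reduced word_prod_cons /=.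
have -> : (s i * word_prod a == w) = (word_prod a == s i * w).
  by apply/eqP/eqP => [<-|->]; rewrite adjK.
case: eqP => [e|_] /=; last by rewrite andbF.
have [di|di] := boolP (desc w i); first by rewrite (ninv_desc di) eqSS.
have := ninv_word a; rewrite e ninv_asc //= => le_a.
by apply/negbTE/eqP; lia.
Qed.

Lemma reduced_nil w : reduced w [::] = (w == 1).
Proof.
rewrite /reduced /word_prod big_nil eq_sym; case: eqP => // ->.
by rewrite ninv1.
Qed.

Lemma reduced_ex w : exists a, reduced w a.
Proof.
have [k] := ubnP (ninv w); elim: k w => // k IHk w.
have [/existsP[i di]|/existsPn nd] := boolP [exists i, desc w i].
  rewrite (ninv_desc di) ltnS => /IHk[a ra].
  by exists (i :: a); rewrite reduced_cons di.
by exists [::]; rewrite reduced_nil (no_desc1 nd).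
Qed.

Lemma coxeter_lengthE w : coxeter_length w = ninv w.
Proof.
have [a /andP[/eqP wa /eqP sa]] := reduced_ex w.
rewrite /coxeter_length; case: ex_minnP => m /existsP[b /eqP wb] min_m.
have := ninv_word b; rewrite wb size_tuple => le_m.
apply/eqP; rewrite eqn_leq le_m andbT; apply: min_m; apply/existsP; exists (Tuple (introT eqP sa)).
by rewrite /= wa.
Qed.

Lemma reduced_exprE w (a : (coxeter_length w).-tuple 'I_n) :
  reduced_expr a = reduced w a.
Proof. by rewrite /reduced size_tuple -(coxeter_lengthE w) eqxx andbT. Qed.

End Length.

(** * Full commutativity and 321-avoidance *)

Section Commutation.
Variable n : nat.
Implicit Types (w : 'S_n.+1) (i j : 'I_n) (a b c : seq 'I_n).
Local Open Scope group_scope.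
Local Notation s := (@adj_transp n).

Lemma nth_swap (T : Type) (x0 x y : T) u v l :
  nth x0 (u ++ y :: x :: v) l =
  nth x0 (u ++ x :: y :: v)
    (if l == size u then (size u).+1 else if l == (size u).+1 then size u else l).
Proof.
rewrite !nth_cat; case: eqP => [->|ne1]; first by rewrite ltnn subnn ltnNge leqnSn subSnn.
case: eqP => [->|ne2]; first by rewrite ltnn subnn ltnNge leqnSn subSnn.
by case: ltnP => // le_l; case E: (l - size u)%N => [|[|m]] //=; lia.
Qed.

Lemma swap_tupleE (T : eqType) k (a b : k.-tuple T) u v x y (i j : 'I_k) :
  tval a = u ++ x :: y :: v -> i = size u :> nat -> j = i.+1 :> nat ->
  (b == [tuple tnth a (tperm i j l) | l < k]) = (tval b == u ++ y :: x :: v).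
Proof.
move=> ea ei ej; rewrite -val_eqE; congr (_ == _).
apply: (@eq_from_nth _ x); first by rewrite size_tuple -(size_tuple a) ea !size_cat.
move=> l; rewrite size_tuple => lt_l.
rewrite nth_swap -ea -(tnth_nth x _ (Ordinal lt_l)) tnth_mktuple (tnth_nth x).
congr nth; rewrite permE /= -!val_eqE /= ej ei.
by case: eqP => _ /=; [rewrite ej ei | case: eqP => _ //=; rewrite ei].
Qed.

Variant commute_swap a b : Prop :=
  CommuteSwap u v i j of a = u ++ i :: j :: v & b = u ++ j :: i :: v & coxeter_m i j = 2.

Lemma commutation_moveP k (a b : k.-tuple 'I_n) :
  reflect (commute_swap a b) (commutation_move a b).
Proof.
apply: (iffP idP) => [/existsP[i /existsP[j /and3P[/eqP ej /eqP mij eb]]]|[u v x y ea eb mxy]].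
  have ea : tval a = take i a ++ tnth a i :: tnth a j :: drop j.+1 a.
    have [x0 _] : exists x0 : 'I_n, True by exists (tnth a i).
    rewrite !(tnth_nth x0) -{1}[tval a](cat_take_drop i); congr (_ ++ _).
    by rewrite (drop_nth x0) ?size_tuple // -ej (drop_nth x0) ?size_tuple.
  have szi : i = size (take i a) :> nat by rewrite size_take size_tuple ltn_ord.
  exists (take i a) (drop j.+1 a) (tnth a i) (tnth a j) => //.
  by apply/eqP; rewrite -(swap_tupleE _ ea szi ej).
have sza := size_tuple a; rewrite ea size_cat /= in sza.
have lti : size u < k by lia.
have ltj : (size u).+1 < k by lia.
apply/existsP; exists (Ordinal lti); apply/existsP; exists (Ordinal ltj).
rewrite (swap_tupleE _ ea) // eb !eqxx /= !(tnth_nth x) /= ea !nth_cat.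
by rewrite ltnn subnn ltnNge leqnSn subSnn /= mxy.
Qed.

(** On sequences without a fixed length the closure is compatible with adding a first letter;
    [commute_connect] returns to tuples. *)
Inductive commute_equiv : seq 'I_n -> seq 'I_n -> Prop :=
| commute_refl a : commute_equiv a a
| commute_step a b c : commute_swap a b -> commute_equiv b c -> commute_equiv a c.

Lemma commute_trans b a c : commute_equiv a b -> commute_equiv b c -> commute_equiv a c.
Proof. by elim=> // a1 b1 c1 sab _ IH /IH; apply: commute_step. Qed.

Lemma commute_cons i a b : commute_equiv a b -> commute_equiv (i :: a) (i :: b).
Proof.
elim=> [c|a1 b1 c1 [u v x y -> -> mxy] _ IH]; first exact: commute_refl.
by apply: commute_step IH; exists (i :: u) v x y.
Qed.

Lemma commute_head i j c : coxeter_m i j = 2 -> commute_equiv [:: i, j & c] [:: j, i & c].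
Proof.
by move=> mij; apply: commute_step (commute_refl _); exists [::] c i j.
Qed.

Lemma commute_connect a b : commute_equiv a b ->
  forall k (ta tb : k.-tuple 'I_n), tval ta = a -> tval tb = b ->
  connect (@commutation_move n k) ta tb.
Proof.
elim=> [c k ta tb ea eb|a1 b1 c1 sab _ IH k ta tb ea eb].
  by rewrite (_ : ta = tb) //; apply: val_inj; rewrite /= ea eb.
have szb : size b1 == k.
  case: sab ea => u v x y -> -> _ ea.
  by rewrite -(size_tuple ta) ea !size_cat.
apply: connect_trans (IH _ (Tuple szb) tb erefl eb); apply: connect1.
by apply/commutation_moveP; rewrite ea.
Qed.

(** The multiset of letters is the invariant that separates the two sides of a braid relation. *)
Lemma connect_perm_eq k (a b : k.-tuple 'I_n) :
  connect (@commutation_move n k) a b -> perm_eq a b.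
Proof.
case/connectP=> p; elim: p a => [|c p IHp] a /= => [_ ->|/andP[/commutation_moveP sac pc] eb].
  exact: perm_refl.
apply: perm_trans (IHp c pc eb).
case: sac => u v x y -> -> _; rewrite perm_cat2l.
by rewrite -cat1s -[y :: x :: v]cat1s -(cat1s y) -(cat1s x v) perm_catCA perm_refl.
Qed.

(** The product squares to the identity and moves [lo i], so its order is the prime 2. *)
Lemma coxeter_m_far i j : (i.+1 < j) || (j.+1 < i) -> coxeter_m i j = 2.
Proof.
move=> far; apply: nt_prime_order => //; last first.
  apply/eqP=> /permP/(_ (lo i)); rewrite permM perm1 adj_lo => /(congr1 (@nat_of_ord _)).
  by have := adj_spec j (hi i); rewrite val_hi /=; lia.
apply/permP=> x; apply: ord_inj; rewrite expgS expg1 !permM perm1.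
have := adj_spec i x; have := adj_spec j (s i x); have := adj_spec i (s j (s i x)).
by have := adj_spec j (s i (s j (s i x))); lia.
Qed.

Definition avoids321 w :=
  [forall x : 'I_n.+1, forall y : 'I_n.+1, forall z : 'I_n.+1,
    ~~ [&& x < y, y < z, w z < w y & w y < w x]].

Lemma avoids321P w :
  reflect (forall x y z : 'I_n.+1, x < y -> y < z -> w z < w y -> w y < w x -> False)
          (avoids321 w).
Proof.
apply: (iffP forallP) => [av x y z h1 h2 h3 h4|av x].
  by have /forallP/(_ y)/forallP/(_ z) := av x; rewrite h1 h2 h3 h4.
apply/forallP=> y; apply/forallP=> z; apply/negP=> /and4P[]; exact: av.
Qed.

(* An ascent at [i] cannot be the two leading or trailing letters of a 321 pattern, so
   exchanging positions [i] and [i + 1] keeps the pattern. *)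
Lemma avoids321_desc w i : avoids321 w -> desc w i -> avoids321 (s i * w).
Proof.
move=> /avoids321P av di; apply/avoids321P=> x y z; rewrite !permM => xy yz lt1 lt2.
have as_i (t u : 'I_n.+1) : t < u -> w (s i u) < w (s i t) -> s i t < s i u.
  move=> ltu ltw; apply: adj_lt => //; apply/negP=> /andP[/eqP et /eqP eu].
  move: ltw di; rewrite (_ : t = lo i); last exact: val_inj.
  rewrite (_ : u = hi i); last exact: val_inj.
  by rewrite adj_lo adj_hi /desc; lia.
exact: (av (s i x) (s i y) (s i z)) (as_i _ _ xy lt2) (as_i _ _ yz lt1) lt1 lt2.
Qed.

Lemma adjacent_lo_hi (x y : 'I_n.+1) : y = x.+1 :> nat -> exists i, x = lo i /\ y = hi i.
Proof.
move=> exy; have lt_x : x < n by move: (ltn_ord y); lia.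
by exists (Ordinal lt_x); split; apply: ord_inj; rewrite ?val_hi.
Qed.

Lemma adj_fix i (x : 'I_n.+1) : x != i :> nat -> x != i.+1 :> nat -> s i x = x.
Proof. by move=> /negbTE h1 /negbTE h2; apply: ord_inj; rewrite val_adj h1 h2. Qed.

(** Induction on the length. Distinct first letters [i] and [j] are both descents of [w], hence not
    adjacent, and they commute. The two words are then linked through [[:: i, j & c]] and
    [[:: j, i & c]], with [c] a reduced word of what remains. *)
Lemma avoids321_commute w a b :
  avoids321 w -> reduced w a -> reduced w b -> commute_equiv a b.
Proof.
have [k] := ubnP (size a); elim: k w a b => // k IHk w [|i a] b lt_a av.
  rewrite reduced_nil => /eqP -> /andP[_]; rewrite ninv1 => /nilP ->.
  exact: commute_refl.
case: b => [|j b]; first by rewrite reduced_nil => + /eqP e1; rewrite e1 /reduced ninv1 andbF.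
rewrite !reduced_cons => /andP[di ra] /andP[dj rb].
have avi := avoids321_desc av di; have avj := avoids321_desc av dj.
have [eij|neij] := eqVneq i j.
  by subst j; apply/commute_cons/(IHk (s i * w)).
(* Descents at two consecutive positions form a 321 pattern on three consecutive positions. *)
have adjacent (i' j' : 'I_n) : j' = i'.+1 :> nat -> desc w i' -> desc w j' -> False.
  rewrite /desc => ej; rewrite (_ : lo j' = hi i'); last exact: ord_inj.
  move=> d1 d2; apply: (avoids321P _ av) d2 d1; rewrite !val_hi ?ej //=.
have far : (i.+1 < j) || (j.+1 < i).
  have neij' : i != j :> nat by [].
  have := adjacent i j; have := adjacent j i; rewrite di dj; lia.
have [c rc] := reduced_ex (s j * (s i * w)).
have mij := coxeter_m_far far.
have sij : s i * s j = s j * s i.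
  apply/permP=> x; apply: ord_inj; rewrite !permM.
  have := adj_spec i x; have := adj_spec j (s i x).
  by have := adj_spec j x; have := adj_spec i (s j x); lia.
have dji : desc (s i * w) j.
  by rewrite /desc !permM !adj_fix // ?val_hi /=; lia.
have dij : desc (s j * w) i.
  by rewrite /desc !permM !adj_fix // ?val_hi /=; lia.
have rjc : reduced (s i * w) (j :: c) by rewrite reduced_cons dji.
have ric : reduced (s j * w) (i :: c) by rewrite reduced_cons dij mulgA sij -mulgA.
have szc : size (i :: c) = size a.
  by case/andP: ra rjc => _ /eqP -> /andP[_ /eqP].
apply: (@commute_trans [:: i, j & c]); first exact: commute_cons (IHk _ _ _ lt_a avi ra rjc).
apply: (@commute_trans [:: j, i & c]); first exact: commute_head.
by apply: commute_cons (IHk _ _ _ _ avj ric rb); rewrite szc.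
Qed.

Lemma adj_braid i j : j = i.+1 :> nat -> s i * (s j * s i) = s j * (s i * s j).
Proof.
move=> ej; apply/permP=> x; apply: ord_inj; rewrite !permM.
have := adj_spec i x; have := adj_spec j (s i x); have := adj_spec i (s j (s i x)).
have := adj_spec j x; have := adj_spec i (s j x); have := adj_spec j (s i (s j x)).
lia.
Qed.

(* Exchanging inner descents shrinks the pattern until it occupies three consecutive
   positions, where the two sides of the braid relation use different letters. *)
Lemma pattern321_words w (x y z : 'I_n.+1) : x < y -> y < z -> w z < w y -> w y < w x ->
  exists a b, [/\ reduced w a, reduced w b & ~~ perm_eq a b].
Proof.
have [m] := ubnP (z - x); elim: m w x y z => // m IHm w x y z lt_m xy yz wyz wxy.
have step i (w' := s i * w) : desc w i ->
    (exists a b, [/\ reduced w' a, reduced w' b & ~~ perm_eq a b]) ->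
  exists a b, [/\ reduced w a, reduced w b & ~~ perm_eq a b].
  move=> di [a [b [ra rb nab]]]; exists (i :: a), (i :: b).
  by rewrite !reduced_cons di perm_cons.
(* The third position moves from [z] to [z.-1]. At an ascent the value at [z.-1] is even smaller
   than [w z], so [w] itself has the shorter pattern; at a descent the exchange brings [w z] to
   [z.-1]. The first position is treated symmetrically below. *)
have [yz1|zy1] := ltnP y.+1 z.
  have lt_z : z.-1 < n.+1 by move: (ltn_ord z); lia.
  pose z' := Ordinal lt_z.
  have [i [e1 e2]] : exists i, z' = lo i /\ z = hi i by apply: adjacent_lo_hi => /=; lia.
  have zi : z = i.+1 :> nat by rewrite e2 val_hi.
  have [di|ndi] := boolP (desc w i).
    apply: (step i di); apply: (IHm _ x y z'); rewrite ?permM /= ; try lia.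
      by rewrite e1 adj_lo -e2 adj_fix //; lia.
    by rewrite !adj_fix //; lia.
  apply: (IHm w x y z') => //=; try lia.
  by move: ndi; rewrite /desc -e1 -e2; lia.
have [xy1|yx1] := ltnP x.+1 y.
  have lt_x : x.+1 < n.+1 by move: (ltn_ord y); lia.
  pose x' := Ordinal lt_x.
  have [i [e1 e2]] : exists i, x = lo i /\ x' = hi i by apply: adjacent_lo_hi.
  have xi : x = i :> nat by rewrite e1.
  have [di|ndi] := boolP (desc w i).
    apply: (step i di); apply: (IHm _ x' y z); rewrite ?permM /= ; try lia.
      by rewrite !adj_fix //; lia.
    by rewrite e2 adj_hi -e1 adj_fix //; lia.
  apply: (IHm w x' y z) => //=; try lia.
  by move: ndi; rewrite /desc -e1 -e2; lia.
have [i [xi yi]] : exists i, x = lo i /\ y = hi i by apply: adjacent_lo_hi; lia.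
have [j [yj zj]] : exists j, y = lo j /\ z = hi j by apply: adjacent_lo_hi; lia.
have ej : j = i.+1 :> nat by rewrite -val_hi -yi yj.
have sxi : s i x = y by rewrite xi adj_lo.
have syi : s i y = x by rewrite yi adj_hi.
have syj : s j y = z by rewrite yj adj_lo.
have szi : s i z = z by rewrite adj_fix // zj val_hi; lia.
have sxj : s j x = x by rewrite adj_fix // xi /=; lia.
have [c rc] := reduced_ex (s i * (s j * (s i * w))).
have ra : reduced w [:: i, j, i & c].
  rewrite !reduced_cons rc /desc -xi -yi -yj -zj !permM.
  rewrite syj sxj szi syi sxi; lia.
exists [:: i, j, i & c], [:: j, i, j & c]; split => //.
  move: ra; rewrite /reduced !word_prod_cons /= => /andP[/eqP <- ->].
  by rewrite andbT !mulgA -(mulgA (s i)) adj_braid // !mulgA.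
have /negbTE ne : j != i by rewrite -val_eqE /= ej; lia.
have /negbTE ne' : i != j by rewrite eq_sym ne.
(* Beyond the common tail [c], the letter [i] occurs twice in one word and once in the other. *)
apply/negP=> /seq.permP/(_ (pred1 i)) /=; rewrite eqxx ne; lia.
Qed.

Lemma fully_commutativeE w : fully_commutative w = avoids321 w.
Proof.
apply/forallP/idP => [fc|av a].
  apply/avoids321P=> x y z xy yz wyz wxy.
  have [a [b [ra rb /negP[]]]] := pattern321_words xy yz wyz wxy.
  have sza : size a == coxeter_length w by case/andP: ra => _; rewrite coxeter_lengthE.
  have szb : size b == coxeter_length w by case/andP: rb => _; rewrite coxeter_lengthE.
  have /forallP/(_ (Tuple szb)) := fc (Tuple sza).
  by rewrite !reduced_exprE ra rb => /connect_perm_eq.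
apply/forallP=> b; apply/implyP; rewrite reduced_exprE => ra.
apply/implyP; rewrite reduced_exprE => rb.
exact: commute_connect (avoids321_commute av ra rb) _ _ _ erefl erefl.
Qed.

(** * Letter multiplicities and crossing numbers *)

Definition cross (w : 'S_n.+1) (k : nat) := #|[set x : 'I_n.+1 | (x <= k) && (k < w x)]|.

(** For [k] other than [i], the transposition [s i] preserves the set of positions at most [k]. *)
Lemma cross_adj w i (k : nat) : k != i :> nat -> cross (s i * w) k = cross w k.
Proof.
move=> ne; rewrite /cross -[RHS](card_preimset _ (@perm_inj _ (s i))).
congr (#|pred_of_set _|); apply/setP=> x; rewrite !inE permM; congr (_ && _).
by have := adj_spec i x; lia.
Qed.

Lemma card_ord_lt m : m <= n.+1 -> #|[set x : 'I_n.+1 | x < m]| = m.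
Proof.
move=> le_m; rewrite -sum1_card (eq_bigl (fun x : 'I_n.+1 => x < m)); last by move=> x; rewrite inE.
by rewrite (big_ord_narrow le_m) sum_nat_const card_ord muln1.
Qed.

(** Pigeonhole: an earlier value above [w (lo i)] would complete a 321 pattern with the descent. If
    [w (lo i) <= i], the first [i.+2] positions would thus all have values among the first
    [i.+1]. *)
Lemma avoids321_desc_lo w i : avoids321 w -> desc w i -> i < w (lo i).
Proof.
move=> /avoids321P av di; rewrite ltnNge; apply/negP=> le_wi.
have sub : w @: [set x : 'I_n.+1 | x < i.+2] \subset [set x : 'I_n.+1 | x < i.+1].
  apply/subsetP=> _ /imsetP[x + ->]; rewrite !inE => lt_x.
  have [ltx|gtx|ex] := ltngtP x (lo i); last by rewrite (ord_inj ex).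
    have := av x (lo i) (hi i) ltx (leqnn _) di; move: (w x) le_wi => wx.
    by rewrite /=; lia.
  rewrite (_ : x = hi i); first by move: di; rewrite /desc; lia.
  by apply: ord_inj; rewrite val_hi; move: gtx => /=; lia.
have := subset_leq_card sub; rewrite card_imset; last exact: perm_inj.
by rewrite !card_ord_lt ?ltnn // ?ltnS; have := ltn_ord i; lia.
Qed.

(** The mirror image: otherwise all positions from [i] on would have values above [i], one value too
    few. *)
Lemma avoids321_desc_hi w i : avoids321 w -> desc w i -> w (hi i) <= i.
Proof.
move=> /avoids321P av di; rewrite leqNgt; apply/negP=> lt_wi.
have sub : w @: (~: [set x : 'I_n.+1 | x < i]) \subset ~: [set x : 'I_n.+1 | x < i.+1].
  apply/subsetP=> _ /imsetP[x + ->]; rewrite !inE => lt_x.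
  have [ltx|gtx|ex] := ltngtP x (hi i); last by rewrite (ord_inj ex); lia.
    rewrite (_ : x = lo i); first by move: di; rewrite /desc; lia.
    by apply: ord_inj; rewrite /=; move: ltx; rewrite val_hi; lia.
  have := av (lo i) (hi i) x (leqnn _) gtx; move: di; rewrite /desc.
  by move: (perm_lo_hi w i); lia.
have := subset_leq_card sub; rewrite card_imset; last exact: perm_inj.
have lt_i := ltn_ord i.
rewrite [X in X <= _]cardsCs [X in _ <= X]cardsCs !setCK.
rewrite card_ord_lt; last lia.
rewrite card_ord_lt; last lia.
rewrite card_ord; lia.
Qed.

(** By the two preceding bounds, the exchange replaces a value above [i] at [lo i] by one that is at
    most [i]; no other position up to [i] is affected. *)
Lemma cross_desc w i : avoids321 w -> desc w i -> cross w i = (cross (s i * w) i).+1.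
Proof.
move=> av di; have lt_lo := avoids321_desc_lo av di; have le_hi := avoids321_desc_hi av di.
rewrite /cross; set A := [set x | _ & _]; set B := [set x | _ & _].
have -> : A = lo i |: B.
  apply/setP=> x; rewrite !inE permM; have [->|ne] := eqVneq x (lo i); first by rewrite leqnn.
  have ne' : x != i :> nat by apply: contra ne => /eqP e; apply/eqP/ord_inj.
  have [le_x|//] := leqP x i; rewrite adj_fix //; lia.
by rewrite cardsU1 (_ : _ \notin _) // inE permM adj_lo leqnn -leqNgt.
Qed.

Lemma avoids321_count w a i : avoids321 w -> reduced w a -> count_mem i a = cross w i.
Proof.
elim: a w => [|j a IHa] w av.
  rewrite reduced_nil => /eqP ->; apply/esym/eqP; rewrite cards_eq0; apply/eqP/setP=> x.
  by rewrite !inE perm1; lia.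
rewrite reduced_cons => /andP[dj ra] /=; rewrite (IHa _ (avoids321_desc av dj) ra).
have [<-|ne] := eqVneq j i; first by rewrite (cross_desc av dj).
by rewrite cross_adj //; apply: contra ne => /eqP/ord_inj ->.
Qed.

Lemma avoids321_length w : avoids321 w -> coxeter_length w = \sum_(i < n) cross w i.
Proof.
move=> av; have [a ra] := reduced_ex w; rewrite coxeter_lengthE.
under eq_bigr do rewrite -(avoids321_count _ av ra).
have /andP[_ /eqP <-] := ra; elim: a {ra} => [|j a IHa] /=; first by rewrite big1.
rewrite big_split -IHa (bigD1 j) //= eqxx big1 => [|i]; first by rewrite addn0 add1n.
by rewrite eq_sym => /negbTE ->.
Qed.

End Commutation.

(** * Involutions and paths *)

Local Notation up := (Some true).
Local Notation down := (Some false).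
Local Notation flat := None.

Definition next_height (h : nat) (c : option bool) : nat :=
  match c with up => h.+1 | down => h.-1 | flat => h end.

Fixpoint is_path (h : nat) (p : seq (option bool)) : bool :=
  if p is c :: p' then
    match c with up => true | down => 0 < h | flat => h == 0 end
      && is_path (next_height h c) p'
  else h == 0.

Fixpoint area (h : nat) (p : seq (option bool)) : nat :=
  if p is c :: p' then next_height h c + area (next_height h c) p' else 0.

Fixpoint paths (L h : nat) : seq (seq (option bool)) :=
  if L is L'.+1 then
    [seq up :: p | p <- paths L' h.+1] ++
    (if h is h'.+1 then [seq down :: p | p <- paths L' h'] else [seq flat :: p | p <- paths L' 0])
  else if h is 0 then [:: [::]] else [::].

Lemma mem_map_cons (T : eqType) (c d : T) (p : seq T) s :
  (c :: p \in [seq d :: q | q <- s]) = (c == d) && (p \in s).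
Proof.
apply/mapP/andP => [[q qs [-> ->]]|[/eqP -> ps]]; first by rewrite eqxx.
by exists p.
Qed.

Lemma mem_paths L h p : (p \in paths L h) = (size p == L) && is_path h p.
Proof.
elim: L h p => [|L IHL] h p; first by case: h p => [|h] [|c p].
rewrite mem_cat; case: p => [|c p] /=.
  by case: h => [|h]; rewrite -[LHS]/(_ || _); apply/orP => -[] /mapP[].
rewrite mem_map_cons IHL eqSS; case: h => [|h]; rewrite mem_map_cons IHL.
all: case: c => [[]|] //=; rewrite ?orbF ?andbF //.
Qed.

Lemma paths_uniq L h : uniq (paths L h).
Proof.
elim: L h => [|L IHL] h; first by case: h.
have inj_cons (c : option bool) : injective (cons c) by move=> ? ? [].
rewrite /= cat_uniq map_inj_uniq // IHL /= andbC; apply/andP; split.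
  by case: h => [|h]; rewrite map_inj_uniq.
by apply/hasPn=> -[|c p]; case: h => [|h] /mapP[q _ // [-> ->]]; rewrite mem_map_cons.
Qed.

Section PathPoly.
Local Open Scope ring_scope.

Definition path_poly (L h : nat) : {poly int} := \sum_(p <- paths L h) 'X^(area h p).

Lemma path_poly0 h : path_poly 0 h = (h == 0%N)%:R.
Proof. by case: h => [|h]; rewrite /path_poly /= ?big_seq1 ?big_nil. Qed.

Lemma path_polyS0 L : path_poly L.+1 0 = 'X * path_poly L 1 + path_poly L 0.
Proof.
rewrite /path_poly /= big_cat !big_map mulr_sumr; congr (_ + _).
by apply: eq_bigr => p _; rewrite exprS.
Qed.

Lemma path_polySS L h :
  path_poly L.+1 h.+1 = 'X^(h.+2) * path_poly L h.+2 + 'X^h * path_poly L h.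
Proof.
rewrite /path_poly /= big_cat !big_map !mulr_sumr.
by congr (_ + _); apply: eq_bigr => p _; rewrite exprD.
Qed.

End PathPoly.

(** * Paths described by the numbers of their steps of each kind *)

Definition rank (c : option bool) (p : seq (option bool)) (k : nat) := count_mem c (take k p).

Lemma rank0 c p : rank c p 0 = 0.
Proof. by rewrite /rank take0. Qed.

Lemma rank_cons c d p k : rank c (d :: p) k.+1 = (d == c) + rank c p k.
Proof. by []. Qed.

Lemma rankS c p k : k < size p -> rank c p k.+1 = rank c p k + (nth flat p k == c).
Proof.
by move=> lt_k; rewrite /rank (take_nth flat) // -cats1 count_cat /= addn0.
Qed.

Lemma rank_mono c p j k : j <= k -> rank c p j <= rank c p k.
Proof.
move=> /subnKC <-; rewrite /rank takeD count_cat; lia.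
Qed.

Lemma rank_lt c p j k : j < k -> j < size p -> nth flat p j = c -> rank c p j < rank c p k.
Proof.
move=> jk js pj; apply: leq_trans (rank_mono _ _ jk).
by rewrite rankS // pj eqxx addn1.
Qed.

(** A discrete intermediate value argument: the rank starts at 0 and grows by at most one, exactly
    at the steps [c]. *)
Lemma rank_onto c p k v : k <= size p -> v < rank c p k ->
  exists j, [/\ j < k, nth flat p j = c & rank c p j = v].
Proof.
elim: k => [|k IHk]; first by rewrite rank0.
move=> lt_k; rewrite rankS //; case: (eqVneq (nth flat p k) c) => [pk|_] /=.
  rewrite addn1 ltnS leq_eqVlt => /predU1P[->|]; first by exists k.
  by move=> /(IHk (ltnW lt_k))[j [? ? ?]]; exists j; split => //; lia.
by rewrite addn0 => /(IHk (ltnW lt_k))[j [? ? ?]]; exists j; split => //; lia.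
Qed.

(** The height after [k] steps is [h] plus the ups minus the downs among them. The conditions are
    kept additive to avoid truncated subtraction. *)
Lemma is_pathP h p :
  reflect [/\ forall k, k < size p -> nth flat p k = flat -> h + rank up p k = rank down p k,
              forall k, k <= size p -> rank down p k <= h + rank up p k
            & h + rank up p (size p) = rank down p (size p)]
          (is_path h p).
Proof.
elim: p h => [|c p IHp] h /=.
  apply: (iffP eqP) => [->|[_ _]]; last by rewrite !rank0 addn0.
  by split=> //; move=> [|k].
apply: (iffP andP) => [[hc /IHp[fl le en]]|[fl le en]].
  split.
  - case=> [|k] lt_k /=; first by move=> ec; rewrite !rank0 addn0; move: hc; rewrite ec => /eqP.
    by move=> /(fl _ lt_k); rewrite !rank_cons; case: c hc {fl le en} => [[]|] /=; lia.
  - case=> [|k] lt_k; first by rewrite !rank0.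
    by have := le _ lt_k; rewrite !rank_cons; case: c hc {fl le en} => [[]|] /=; lia.
  - by move: en; rewrite !rank_cons; case: c hc {fl le} => [[]|] /=; lia.
have hc : (match c with up => true | down => 0 < h | flat => h == 0 end : bool).
  case: c fl le {en} => [[]|] fl le //.
    by have := le 1 isT; rewrite !rank_cons !rank0 /=; lia.
  by have := fl 0 isT erefl; rewrite !rank0; lia.
split=> //; apply/IHp; split.
- move=> k lt_k pk; have := fl k.+1 lt_k pk.
  by rewrite !rank_cons; case: c hc {fl le en} => [[]|] /=; lia.
- move=> k lt_k; have := le k.+1 lt_k.
  by rewrite !rank_cons; case: c hc {fl le en} => [[]|] /=; lia.
- by move: en; rewrite !rank_cons; case: c hc {fl le} => [[]|] /=; lia.
Qed.

Lemma area_rank h p : is_path h p ->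
  area h p = \sum_(k < size p) (h + rank up p k.+1 - rank down p k.+1).
Proof.
elim: p h => [|c p IHp] h /=; first by rewrite big_ord0.
case/andP=> hc /IHp ->; rewrite big_ord_recl; congr (_ + _).
  by rewrite !rank_cons !rank0; case: c hc => [[]|] /=; lia.
by apply: eq_bigr => k _; rewrite !lift0 !rank_cons; case: c hc => [[]|] /=; lia.
Qed.

(** * The bijection between 321-avoiding involutions and paths *)

Section Matching.
Variable n : nat.
Implicit Types (w : 'S_n.+1) (x y z : 'I_n.+1) (p : seq (option bool)).
Local Open Scope group_scope.

(** A relation rather than a function: [matched_fun] holds for any sequence of steps of the right
    size, and only [matched_total] uses the path condition. The relation serves both to build an
    involution from a path and to recover it. *)
Definition matched p x y : bool :=
  match nth flat p x, nth flat p y with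
  | up, down => rank up p x == rank down p y
  | down, up => rank down p x == rank up p y
  | flat, flat => x == y
  | _, _ => false
  end.

Lemma matched_sym p x y : matched p x y = matched p y x.
Proof.
by rewrite /matched; case: (nth flat p x) (nth flat p y) => [[]|] [[]|] //; rewrite eq_sym.
Qed.

Lemma rank_inj c p x y : size p = n.+1 -> nth flat p x = c -> nth flat p y = c ->
  rank c p x = rank c p y -> x = y.
Proof.
move=> sp px py exy; apply: ord_inj; case: (ltngtP x y) => // lt_xy.
  by have := rank_lt lt_xy _ px; rewrite sp ltn_ord exy ltnn => /(_ isT).
by have := rank_lt lt_xy _ py; rewrite sp ltn_ord exy ltnn => /(_ isT).
Qed.

Lemma matched_fun p x y z : size p = n.+1 -> matched p x y -> matched p x z -> y = z.
Proof.
move=> sp; rewrite /matched; case: (nth flat p x) => [[]|].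
- case py: (nth flat p y) => [[]|] // /eqP e; case pz: (nth flat p z) => [[]|] // /eqP.
  by rewrite e => /(rank_inj sp py pz).
- case py: (nth flat p y) => [[]|] // /eqP e; case pz: (nth flat p z) => [[]|] // /eqP.
  by rewrite e => /(rank_inj sp py pz).
- by case: (nth flat p y) => // /eqP <-; case: (nth flat p z) => // /eqP.
Qed.

Lemma matched_total p x : size p = n.+1 -> is_path 0 p -> exists y, matched p x y.
Proof.
move=> sp /is_pathP[_ _]; rewrite add0n => en; rewrite /matched.
have onto c d : nth flat p x = c -> rank c p (size p) = rank d p (size p) ->
    exists y, nth flat p y = d /\ rank c p x = rank d p y.
  move=> px ecd; have lt_x : x < size p by rewrite sp.
  have := rank_lt lt_x lt_x px; rewrite ecd => /(rank_onto (leqnn _))[j [lt_j pj rj]].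
  by rewrite sp in lt_j; exists (Ordinal lt_j); rewrite /= pj rj.
case px: (nth flat p x) => [[]|]; last by exists x; rewrite px.
  by have [y [py e]] := onto _ _ px en; exists y; rewrite py e.
by have [y [py e]] := onto _ _ px (esym en); exists y; rewrite py e.
Qed.

(* Ups and downs are matched first in, first out: the arcs of a 321-avoiding
   involution cannot be nested. *)
Lemma path_perm p : size p = n.+1 -> is_path 0 p ->
  exists2 w : 'S_n.+1, involutive w & forall x, matched p x (w x).
Proof.
move=> sp pp; pose f x := odflt x [pick y | matched p x y].
have fP x : matched p x (f x).
  rewrite /f; case: pickP => //= no; have [y] := matched_total x sp pp.
  by rewrite no.
have fK : involutive f.
  by move=> x; apply: matched_fun sp (fP _) _; rewrite matched_sym.
by exists (perm (inv_inj fK)) => [x|x]; rewrite !permE.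
Qed.

Definition step_type w x : option bool :=
  if x < w x then up else if w x < x then down else flat.

Definition perm_path w : seq (option bool) := [seq step_type w x | x <- enum 'I_n.+1].

Lemma size_perm_path w : size (perm_path w) = n.+1.
Proof. by rewrite size_map size_enum_ord. Qed.

Lemma nth_perm_path w x : nth flat (perm_path w) x = step_type w x.
Proof. by rewrite (nth_map x) ?size_enum_ord // nth_ord_enum. Qed.

(** The matching is increasing on steps of the same kind, and a flat step is a fixed point that no
    arc passes over. A 321 pattern would hence consist of ups and downs only; two of its three
    positions would have the same kind, and their values would increase. *)
Lemma path_onto p : size p = n.+1 -> is_path 0 p ->
  exists w, [/\ avoids321 w, involutive w & perm_path w = p].
Proof.
move=> sp pp; have [w wK wP] := path_perm sp pp; exists w.
have /is_pathP[fl le _] := pp; rewrite sp in fl le.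
have lt_p x : x < size p by rewrite sp.
(* A partner before [x] would make the downs exceed the ups just after it. *)
have up_lt x : nth flat p x = up -> nth flat p (w x) = down /\ x < w x.
  move=> px; have := wP x; rewrite /matched px.
  case py: (nth flat p (w x)) => [[]|] // /eqP e; split=> //.
  case: (ltngtP x (w x)) => // [gt_x|/ord_inj ex]; last by rewrite -ex px in py.
  have := le (w x).+1 (ltn_ord _); rewrite add0n rankS // py /= -e.
  by have := rank_mono up p gt_x; lia.
have down_gt x : nth flat p x = down -> nth flat p (w x) = up /\ w x < x.
  move=> px; have := wP x; rewrite /matched px.
  case py: (nth flat p (w x)) => [[]|] // _; split=> //.
  by have [_] := up_lt _ py; rewrite wK.
have flat_fix x : nth flat p x = flat -> w x = x.
  by move=> px; have := wP x; rewrite /matched px; case: (nth flat p (w x)) => // /eqP.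
have incr x y : nth flat p x = nth flat p y -> x < y -> w x < w y.
  move=> pxy lt_xy; have rlt := rank_lt lt_xy (lt_p x) pxy.
  case py: (nth flat p y) => [[]|]; rewrite py in pxy rlt;
    have := wP x; have := wP y; rewrite /matched pxy py.
  - case: (nth flat p (w y)) => [[]|] // /eqP ey; case: (nth flat p (w x)) => [[]|] // /eqP ex.
    by rewrite ex ey in rlt; have := rank_mono down p (_ : w y <= w x); lia.
  - case: (nth flat p (w y)) => [[]|] // /eqP ey; case: (nth flat p (w x)) => [[]|] // /eqP ex.
    by rewrite ex ey in rlt; have := rank_mono up p (_ : w y <= w x); lia.
  - by rewrite !flat_fix.
(* Ups and downs are balanced before a flat step, so an up before [x] has its partner before [x]
   too. *)
have flat_lt x y : nth flat p x = flat -> y < x -> w y < x.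
  move=> px lt_yx; case py: (nth flat p y) => [[]|].
  - have := wP y; rewrite /matched py; case: (nth flat p (w y)) => [[]|] // /eqP ey.
    have := rank_lt lt_yx (lt_p y) py; rewrite ey; have := fl x (ltn_ord _) px.
    by rewrite add0n => ->; have := rank_mono down p (_ : x <= w y); lia.
  - by have [_ /ltn_trans] := down_gt _ py; apply.
  - by rewrite flat_fix.
have flat_gt x y : nth flat p x = flat -> x < y -> x < w y.
  move=> px lt_xy; case: (ltngtP x (w y)) => // [/(flat_lt _ _ px)|/ord_inj ex].
    by rewrite wK; lia.
  by move: lt_xy; rewrite -[y]wK -ex flat_fix // ltnn.
split=> //; last first.
  apply: (@eq_from_nth _ flat); rewrite size_perm_path ?sp // => i lt_i.
  rewrite (nth_perm_path w (Ordinal lt_i)) /step_type /=; set x := Ordinal lt_i.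
  rewrite -[i]/(nat_of_ord x); case px: (nth flat p x) => [[]|].
  - by have [_ ->] := up_lt _ px.
  - by have [_ lt_x] := down_gt _ px; rewrite lt_x ltnNge ltnW.
  - by rewrite flat_fix // ltnn.
apply/avoids321P=> x y z xy yz wyz wxy.
case px: (nth flat p x) => [[]|]; last first.
  by have := flat_gt _ _ px xy; rewrite (flat_fix _ px) in wxy; lia.
all: case py: (nth flat p y) => [[]|];
  try by have := flat_lt _ _ py xy; rewrite (flat_fix _ py) in wxy; lia.
all: try by have := incr x y; rewrite px py => /(_ erefl xy); lia.
all: case pz: (nth flat p z) => [[]|];
  try by have := flat_lt _ _ pz yz; rewrite (flat_fix _ pz) in wyz; lia.
all: try by have := incr y z; rewrite py pz => /(_ erefl yz); lia.
all: by have := incr x z; rewrite px pz => /(_ erefl (ltn_trans xy yz)); lia.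
Qed.

Lemma rank_card c p k : size p = n.+1 ->
  rank c p k = #|[set x : 'I_n.+1 | (x < k) && (nth flat p x == c)]|.
Proof.
move=> sp; elim: k => [|k IHk].
  by rewrite rank0; apply/esym/eqP; rewrite cards_eq0; apply/eqP/setP=> x; rewrite !inE.
have [lt_k|le_k] := ltnP k n.+1; last first.
  rewrite /rank !take_oversize ?sp // in IHk *; last by rewrite leqW.
  rewrite IHk; congr (#|pred_of_set _|); apply/setP=> x; rewrite !inE.
  by rewrite !(leq_trans (ltn_ord x)) // leqW.
rewrite rankS ?sp // IHk; set A := [set x | _ & _]; set B := [set x | _ & _].
pose y := Ordinal lt_k; rewrite -[k in nth _ _ k]/(nat_of_ord y).
have yA : y \notin A by rewrite inE ltnn.
have [py|npy] := eqVneq (nth flat p y) c.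
  have -> : B = y |: A; last by rewrite cardsU1 yA addnC.
  apply/setP=> x; rewrite !inE; have [->|ne] := eqVneq x y; first by rewrite py eqxx ltnSn.
  by congr (_ && _); rewrite -val_eqE /= in ne; lia.
rewrite addn0; congr (#|pred_of_set _|); apply/setP=> x; rewrite !inE.
have [->|ne] := eqVneq x y; first by rewrite (negbTE npy) !andbF.
by congr (_ && _); rewrite -val_eqE /= in ne; lia.
Qed.

Lemma step_type_up w x : (step_type w x == up) = (x < w x).
Proof. by rewrite /step_type; case: ifP => //; case: ifP. Qed.

Lemma step_type_down w x : (step_type w x == down) = (w x < x).
Proof. by rewrite /step_type; case: ltngtP. Qed.

Lemma rank_perm_path_up w k :
  rank up (perm_path w) k = #|[set x : 'I_n.+1 | (x < k) && (x < w x)]|.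
Proof.
rewrite rank_card ?size_perm_path //; congr (#|pred_of_set _|); apply/setP=> x.
by rewrite !inE nth_perm_path step_type_up.
Qed.

Lemma rank_perm_path_down w k :
  rank down (perm_path w) k = #|[set x : 'I_n.+1 | (x < k) && (w x < x)]|.
Proof.
rewrite rank_card ?size_perm_path //; congr (#|pred_of_set _|); apply/setP=> x.
by rewrite !inE nth_perm_path step_type_down.
Qed.

(** Among the ups before [k], those with partner before [k] are carried by [w] onto the downs before
    [k]; the others are the open arcs. The height after [k.+1] steps is thus [cross w k]. *)
Lemma rank_perm_path w k : involutive w ->
  rank up (perm_path w) k = rank down (perm_path w) k + #|[set x : 'I_n.+1 | x < k <= w x]|.
Proof.
move=> wK; rewrite rank_perm_path_up rank_perm_path_down.
set A := [set x | _ & _]; set B := [set x | _ & _]; set C := [set x | _ & _].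
rewrite -(cardsID C A) addnC; congr (_ + _); last first.
  by congr (#|pred_of_set _|); apply/setP=> x; rewrite !inE; lia.
rewrite -(card_imset _ (@perm_inj _ w)); congr (#|pred_of_set _|); apply/setP=> x.
by rewrite -{1}[x]wK (mem_imset _ _ (@perm_inj _ w)) !inE wK; lia.
Qed.

Lemma perm_path_is_path w : avoids321 w -> involutive w -> is_path 0 (perm_path w).
Proof.
move=> /avoids321P av wK; apply/is_pathP; rewrite size_perm_path.
split=> [k lt_k||]; rewrite ?add0n.
- rewrite rank_perm_path // (nth_perm_path w (Ordinal lt_k)) => tk.
  rewrite -[RHS]addn0; congr (_ + _).
  apply/eqP; rewrite cards_eq0; apply/eqP/setP=> x; rewrite !inE; apply/negP=> /andP[lt_x le_w].
  set y := Ordinal lt_k in tk.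
  have wy : w y = y by apply: ord_inj; move: tk; rewrite /step_type; case: ltngtP.
  have ne : w x != y by rewrite -wy (inj_eq perm_inj) -val_eqE /=; lia.
  rewrite -val_eqE /= in ne.
  (* An arc from [x] to [w x] over the fixed point [y] is a 321 pattern. *)
  by apply: (av x y (w x)); rewrite ?wK ?wy //=; lia.
- by move=> k _; rewrite add0n rank_perm_path // leq_addr.
- rewrite rank_perm_path // -[RHS]addn0; congr (_ + _).
  by apply/eqP; rewrite cards_eq0; apply/eqP/setP=> x; rewrite !inE; have := ltn_ord (w x); lia.
Qed.

Lemma area_perm_path w : avoids321 w -> involutive w ->
  area 0 (perm_path w) = coxeter_length w.
Proof.
move=> av wK; rewrite area_rank ?perm_path_is_path // avoids321_length // size_perm_path.
(* There are [n.+1] heights but only [n] letters; the final height is 0. *)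
rewrite big_ord_recr /= [X in _ + X](_ : _ = 0) ?addn0; last first.
  rewrite add0n rank_perm_path // addKn; apply/eqP; rewrite cards_eq0; apply/eqP/setP=> x.
  by rewrite !inE; have := ltn_ord (w x); lia.
by apply: eq_bigr => k _; rewrite add0n rank_perm_path // addKn.
Qed.

(** Two ups [y < z] with [w z < w y] would give the 321 pattern [y], [z], [w z]. Thus [w] is
    increasing on ups, and the ups before [y] correspond to the downs before [w y]. *)
Lemma perm_path_matched w x : avoids321 w -> involutive w -> matched (perm_path w) x (w x).
Proof.
move=> /avoids321P av wK.
have incr y z : y < z -> y < w y -> z < w z -> w y < w z.
  move=> yz yw zw; have := av y z (w z) yz zw; rewrite wK => /(_ zw).
  have ne : w y != w z by rewrite (inj_eq perm_inj) -val_eqE /=; lia.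
  by rewrite -val_eqE /= in ne; lia.
have upP y : y < w y -> matched (perm_path w) y (w y).
  move=> yw; rewrite /matched !nth_perm_path {1 2}/step_type wK yw ltnNge ltnW //=.
  rewrite rank_perm_path_up rank_perm_path_down -(card_imset _ (@perm_inj _ w)).
  apply/eqP; congr (#|pred_of_set _|); apply/setP=> z.
  rewrite -{1}[z]wK (mem_imset _ _ (@perm_inj _ w)) !inE wK.
  case wz: (w z < z); rewrite ?andbF // !andbT; apply/idP/idP => lt_z.
    by have := incr _ _ lt_z _ yw; rewrite wK; apply.
  case: (ltngtP (w z) y) => // [gt_z|/ord_inj ez]; last by move: lt_z; rewrite -ez wK ltnn.
  by have := incr _ _ gt_z yw; rewrite wK => /(_ wz); lia.
case: (ltngtP x (w x)) => [|lt_x|/ord_inj ex]; first exact: upP.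
  by rewrite matched_sym -{2}[x]wK upP // wK.
by rewrite /matched -ex !nth_perm_path /step_type -ex ltnn eqxx.
Qed.

Lemma fc_involutionP w : reflect (avoids321 w /\ involutive w) (fc_involution w).
Proof.
rewrite /fc_involution fully_commutativeE; apply: (iffP andP) => -[av w2]; split=> //.
  by move/eqP: w2; rewrite expgS expg1 => w2 x; rewrite -permM w2 perm1.
by apply/eqP/permP=> x; rewrite expgS expg1 permM perm1 w2.
Qed.

Lemma perm_path_inj : {in @fc_involution n &, injective perm_path}.
Proof.
move=> w w' /fc_involutionP[av wK] /fc_involutionP[av' wK'] eww'.
apply/permP=> x; apply: matched_fun (size_perm_path w) (perm_path_matched _ av wK) _.
by rewrite eww' perm_path_matched.
Qed.

End Matching.

Lemma fc_inv_polyE n : fc_inv_poly n = path_poly n.+1 0.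
Proof.
rewrite /fc_inv_poly /path_poly.
rewrite (eq_bigr (fun w => 'X^(area 0 (perm_path w)))%R); last first.
  by move=> w /fc_involutionP[av wK]; rewrite area_perm_path.
rewrite -big_enum -(big_map (@perm_path n) predT (fun p => 'X^(area 0 p))%R).
apply: perm_big; apply: uniq_perm; rewrite ?paths_uniq //.
  rewrite map_inj_in_uniq ?enum_uniq // => w w'; rewrite !mem_enum.
  exact: perm_path_inj.
move=> p; rewrite mem_paths; apply/mapP/andP => [[w]|[/eqP sp pp]].
  rewrite mem_enum => /fc_involutionP[av wK] ->.
  by rewrite size_perm_path eqxx perm_path_is_path.
have [w [av wK <-]] := path_onto sp pp.
by exists w => //; rewrite mem_enum; apply/fc_involutionP.
Qed.

(** * Generating functions *)

Local Open Scope ring_scope.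

Lemma eq_fps_div (K : fieldType) (f f' d d' : nat -> K) :
  f =1 f' -> d =1 d' -> fps_div f d =1 fps_div f' d'.
Proof.
move=> ef ed n; elim/ltn_ind: n => n IHn; rewrite !fps_divE ef ed; congr ((_ - _) / _).
by apply: eq_bigr => i _; rewrite IHn // ed.
Qed.

(** * Unrestricted paths and q-binomial coefficients *)

Section BilateralPaths.
Variables (K : fieldType) (q : K).
Hypothesis q_neq0 : q != 0.
Hypothesis q_not_root : forall i, q ^+ i.+1 != 1.
Local Notation p := (q ^+ 2).

Lemma q_pochhammerS m : q_pochhammer p p m.+1 = q_pochhammer p p m * (1 - p ^+ m.+1).
Proof. by rewrite /q_pochhammer big_ord_recr /= -exprS. Qed.

Lemma q_pochhammer_neq0 m : q_pochhammer p p m != 0.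
Proof.
elim: m => [|m IHm]; first by rewrite /q_pochhammer big_ord0 oner_eq0.
rewrite q_pochhammerS mulf_neq0 // subr_eq0 eq_sym -exprM.
by rewrite mul2n; apply: q_not_root.
Qed.

Lemma q_binomial0 m : q_binomial p m 0 = 1.
Proof.
rewrite /q_binomial subn0 {2}/q_pochhammer big_ord0 mul1r divff //.
exact: q_pochhammer_neq0.
Qed.

(** Writing the indices through [a] and [b] makes every subtraction exact and keeps each lower index
    within its upper one, where [q_binomial] is meaningful. *)
Lemma q_pascal a b :
  q_binomial p (a + b).+2 a.+1 =
  q_binomial p (a + b).+1 a.+1 + p ^+ b.+1 * q_binomial p (a + b).+1 a.
Proof.
rewrite /q_binomial (_ : (a + b).+2 - a.+1 = b.+1)%N; last lia.
rewrite (_ : (a + b).+1 - a.+1 = b)%N; last lia.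
rewrite (_ : (a + b).+1 - a = b.+1)%N; last lia.
have := q_pochhammer_neq0 a.+1; have := q_pochhammer_neq0 b.+1.
rewrite (q_pochhammerS (a + b).+1) !(q_pochhammerS a) !(q_pochhammerS b).
have -> : p ^+ (a + b).+2 = p ^+ a.+1 * p ^+ b.+1 by rewrite -exprD addSn addnS.
rewrite !mulf_eq0 !negb_or => /andP[nb nb1] /andP[na na1].
move: (p ^+ a.+1) (p ^+ b.+1) na1 nb1 => x y na1 nb1.
by field; rewrite ?na ?nb ?na1 ?nb1.
Qed.

(* The sum of [q ^ (sum of the heights after each step)] over the paths of length [L] with
   steps +1 and -1 from height [h] to height 0, which may go below 0; [u] is the number
   of steps +1. *)
Definition bilateral (h L : nat) : K :=
  let u := (L - h)./2 in
  if (h <= L)%N && ~~ odd (L - h)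
  then q_binomial p L u * q ^ ('C(h, 2)%:Z - (u ^ 2)%N%:Z) else 0.

Lemma bilateralE h u :
  bilateral h (h + u.*2) = q_binomial p (h + u.*2) u * q ^ ('C(h, 2)%:Z - (u ^ 2)%N%:Z).
Proof. by rewrite /bilateral leq_addr addKn odd_double doubleK. Qed.

Lemma bilateral_odd h u : bilateral h (h + u.*2).+1 = 0.
Proof. by rewrite /bilateral -addnS addKn /= odd_double andbF. Qed.

Lemma bilateral_lt h L : (L < h)%N -> bilateral h L = 0.
Proof. by rewrite /bilateral ltnNge => /negbTE ->. Qed.

(** The two terms correspond to a first step up or down. With [u] ups, this is the q-Pascal rule for
    [u > 0]; for [u = 0] all steps go down, and short or wrong-parity lengths give zeros. *)
Lemma bilateralSS h L :
  bilateral h.+1 L.+1 = q ^+ h.+2 * bilateral h.+2 L + q ^+ h * bilateral h L.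
Proof.
have [lt_L|] := ltnP L h; first by rewrite !bilateral_lt ?mulr0 ?addr0 //; lia.
move=> /subnKC <-; rewrite -(odd_double_half (L - h)).
case: (odd _) => /=; move: (_./2) => u.
  rewrite !add1n addnS -addSn !bilateral_odd mulr0 addr0.
  case: u => [|u]; first by rewrite bilateral_lt ?mulr0 //; lia.
  by rewrite doubleS (_ : _ + _ = (h.+2 + u.*2).+1)%N ?bilateral_odd ?mulr0 //; lia.
rewrite add0n -addSn !bilateralE; case: u => [|a].
  rewrite !addn0 !q_binomial0 bilateral_lt // mulr0 add0r !mul1r !subr0.
  by rewrite binS bin1 exprnP -expfzDr // PoszD addrC.
have eL : (h + a.+1.*2 = h.+2 + a.*2)%N by rewrite doubleS; lia.
rewrite {1}eL bilateralE -eL addSn.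
have -> : (h + a.+1.*2 = (a + (h + a.+1)).+1)%N by rewrite -addnn; lia.
rewrite q_pascal; move: (q_binomial _ _ a.+1) (q_binomial _ _ a) => X Y.
have e1 : q ^+ h * q ^ ('C(h, 2)%:Z - (a.+1 ^ 2)%N%:Z) = q ^ ('C(h.+1, 2)%:Z - (a.+1 ^ 2)%N%:Z).
  by rewrite [q ^+ h]exprnP -expfzDr // binS bin1; congr (_ ^ _); lia.
have e2 : q ^+ h.+2 * q ^ ('C(h.+2, 2)%:Z - (a ^ 2)%N%:Z) =
    p ^+ (h + a.+1).+1 * q ^ ('C(h.+1, 2)%:Z - (a.+1 ^ 2)%N%:Z).
  rewrite -exprM [q ^+ h.+2]exprnP [q ^+ (2 * _)]exprnP -!expfzDr // !(binS _.+1) !bin1.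
  by congr (_ ^ _); rewrite -!mulnn; lia.
rewrite [q ^+ h.+2 * _]mulrCA e2 [q ^+ h * _]mulrCA e1.
by rewrite mulrDl [RHS]addrC; congr (_ + _); rewrite mulrCA mulrA.
Qed.

Definition denominator (n : nat) : K :=
  if n is m.+1 then bilateral 0 m.+1 - q * bilateral 1 m - bilateral 0 m else 1.

(* For [h > 0] both sides obey the same recursion in [n], and [denominator] is exactly
   the defect of [bilateral] in the recursion of [F] at [h = 0]. *)
Lemma convolution_denominator (F : nat -> nat -> K) :
    (forall h, F 0%N h = (h == 0%N)%:R) ->
    (forall L, F L.+1 0%N = q * F L 1%N + F L 0%N) ->
    (forall L h, F L.+1 h.+1 = q ^+ h.+2 * F L h.+2 + q ^+ h * F L h) ->
  forall n h, fps_mul (F ^~ h) denominator n = bilateral h n.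
Proof.
move=> F0 FS0 FSS; rewrite /fps_mul; elim=> [|n IHn] h.
  rewrite big_ord1 F0 mulr1; case: h => [|h]; last by rewrite bilateral_lt.
  by rewrite /bilateral q_binomial0 mul1r.
(* The split-off term contains [F 0 h], so it contributes [denominator n.+1] for [h = 0] and
   vanishes otherwise. *)
rewrite big_ord_recl F0 subn0; case: h => [|h].
  under eq_bigr => i _ do rewrite lift0 FS0 subSS mulrDl -mulrA.
  by rewrite big_split -mulr_sumr !IHn /= mul1r; ring.
under eq_bigr => i _ do rewrite lift0 FSS subSS mulrDl -(mulrA (q ^+ h.+2)) -(mulrA (q ^+ h)).
by rewrite big_split -!mulr_sumr !IHn /= mul0r add0r bilateralSS.
Qed.

Lemma bilateral0_even u :
  bilateral 0 u.*2 = q_binomial p u.*2 u * q ^ (- (u ^ 2)%N%:Z).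
Proof. by rewrite -[u.*2]add0n bilateralE sub0r. Qed.

Lemma bilateral0_odd u : bilateral 0 u.*2.+1 = 0.
Proof. exact: (bilateral_odd 0 u). Qed.

Lemma bilateral1_even u : bilateral 1 u.*2 = 0.
Proof. by case: u => [|u]; [rewrite bilateral_lt | exact: (bilateral_odd 1 u)]. Qed.

Lemma bilateral1_odd u :
  bilateral 1 u.*2.+1 = q_binomial p u.*2.+1 u * q ^ (- (u ^ 2)%N%:Z).
Proof. by rewrite -[u.*2.+1]add1n bilateralE sub0r. Qed.

(** Parity leaves one summand: [bilateral 0] for even [j], and [q * bilateral 1] for odd [j], whose
    factor [q] is the extra exponent. *)
Lemma numeratorE j :
  q * bilateral 1 j + bilateral 0 j =
  q_binomial p j j./2 * q ^ (- ((j./2 ^ 2)%N%:Z) + (odd j : nat)%:Z).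
Proof.
rewrite -{1 2 3}(odd_double_half j); case: (odd j); move: (j./2) => u /=.
  rewrite add1n bilateral0_odd bilateral1_odd addr0 mulrCA.
  by rewrite -[X in _ * (X * _)](expr1z q) -expfzDr // addrC.
by rewrite add0n bilateral0_even bilateral1_even mulr0 add0r addr0.
Qed.

(** In odd degree only one term survives. In positive even degree the q-Pascal rule splits the
    central q-binomial, and one part cancels against [q * bilateral 1]. *)
Lemma denominatorE j :
  denominator j =
  if j == 0%N then 1
  else (- 1) ^+ j * (q_binomial p j.-1 j./2 * q ^ (- ((j./2 ^ 2)%N%:Z))).
Proof.
case: j => [|j] //=; rewrite -(odd_double_half j) -signr_odd.
case: (odd j) => /=; move: (j./2) => u; rewrite ?add1n ?add0n /= ?odd_double ?doubleK.
  rewrite expr0 mul1r bilateral0_odd subr0 bilateral1_odd -doubleS bilateral0_even.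
  rewrite doubleS -addnn q_pascal mulrDl -addrA -[RHS]addr0; congr (_ + _).
  have e : q * q ^ (- (u ^ 2)%N%:Z) = p ^+ u.+1 * q ^ (- (u.+1 ^ 2)%N%:Z).
    rewrite -exprM -[X in X * _ = _](expr1z q) [q ^+ _]exprnP -!expfzDr //; congr (_ ^ _).
    by rewrite -!mulnn; lia.
  by rewrite [q * _]mulrCA e; move: (p ^+ u.+1) (q ^ _) (q_binomial _ _ _) => x y z; ring.
rewrite uphalf_double expr1 bilateral0_odd bilateral1_even bilateral0_even.
by rewrite mulr0 subr0 sub0r mulN1r.
Qed.

End BilateralPaths.

Lemma qvar_neq0 : qvar != 0.
Proof. by rewrite tofrac_eq0 polyX_eq0. Qed.

Lemma qvar_not_root i : qvar ^+ i.+1 != 1.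
Proof.
rewrite -tofracXn -tofrac1 tofrac_eq; apply/eqP=> /(congr1 (fun r : {poly int} => size r)).
by rewrite size_polyXn size_poly1.
Qed.

Theorem theorem6p4 :
  (fun n : nat => tofrac (fc_inv_poly n)) =1
  fps_div
    (fun j : nat =>
       q_binomial (qvar ^+ 2) j j./2
         * qvar ^ (- ((j./2 ^ 2)%N%:Z) + (odd j : nat)%:Z))
    (fun j : nat =>
       if j == 0%N then 1
       else (- 1) ^+ j * (q_binomial (qvar ^+ 2) j.-1 j./2
                            * qvar ^ (- ((j./2 ^ 2)%N%:Z)))).
Proof.
pose F L h : {fraction {poly int}} := tofrac (path_poly L h).
have F0 h : F 0%N h = (h == 0%N)%:R by rewrite /F path_poly0 rmorph_nat.
have FS0 L : F L.+1 0%N = qvar * F L 1%N + F L 0%N by rewrite /F path_polyS0 rmorphD rmorphM.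
have FSS L h : F L.+1 h.+1 = qvar ^+ h.+2 * F L h.+2 + qvar ^+ h * F L h.
  by rewrite /F /qvar -!tofracXn -!tofracM -tofracD path_polySS.
have conv := convolution_denominator qvar_neq0 qvar_not_root F0 FS0 FSS.
(* Type $A_n$ acts on [n.+1] letters, hence paths with [n.+1] steps; by [FS0] this shift turns the
   product with the denominator into [q * bilateral 1 + bilateral 0]. *)
pose A n := F n.+1 0%N.
have num : fps_mul A (denominator qvar) =1 fun j =>
    q_binomial (qvar ^+ 2) j j./2 * qvar ^ (- ((j./2 ^ 2)%N%:Z) + (odd j : nat)%:Z).
  move=> n; rewrite -(numeratorE qvar_neq0) -!conv /fps_mul mulr_sumr -big_split.
  by apply: eq_bigr => i _; rewrite /A FS0 /= mulrDl mulrA.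
move=> n; rewrite fc_inv_polyE -[LHS]/(A n).
rewrite -(eq_fps_div num (denominatorE qvar_neq0 qvar_not_root)) fps_mulK //.
exact: oner_neq0.
Qed.
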